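(* Let $n\ge1$ be the number of surfaces and suppose the current game between players $i$ and $j$ is played on surface $m\in\{1,\dots,n\}$. Let $J$ and $H$ be the gradient and Hessian of the log-posterior $\ell$ (see context), and let $\boldsymbol\mu$ be the prior mean. Let $\hat p_{ij}=p_{ij}(\boldsymbol\mu)$ and $\hat p_{ji}=1-\hat p_{ij}$. Then $$-H^{-1}(\boldsymbol\mu)J(\boldsymbol\mu)=\begin{bmatrix}\boldsymbol k_i\,(s_{ij}-\hat p_{ij})\\ \boldsymbol k_j\,(s_{ji}-\hat p_{ji})\end{bmatrix},$$ where $\boldsymbol k_i,\boldsymbol k_j\in\mathbb R^n$ are $$\boldsymbol k_i=bC\sigma_m\begin{bmatrix}\sigma_1\rho_{1m}\\ \sigma_2\rho_{2m}\\ \vdots\\ \sigma_n\rho_{nm}\end{bmatrix},\qquad \boldsymbol k_j=bC\tau_m\begin{bmatrix}\tau_1\rho_{1m}\\ \tau_2\rho_{2m}\\ \vdots\\ \tau_n\rho_{nm}\end{bmatrix},$$ with $$C=\bigl(1+b^2\hat p_{ij}\hat p_{ji}(\sigma_m^2+\tau_m^2)\bigr)^{-1}.$$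
   Context: Setting. There are $n$ types of playing surfaces. Players $i$ and $j$ have strength vectors $\boldsymbol\theta_i=(\theta_{i1},\dots,\theta_{in})^T$ and $\boldsymbol\theta_j=(\theta_{j1},\dots,\theta_{jn})^T$ with independent normal priors $N(\boldsymbol\mu_i,\Lambda_i)$ and $N(\boldsymbol\mu_j,\Lambda_j)$, where $\Lambda_i=(\sigma_{kl})_{k,l=1}^n$ and $\Lambda_j=(\tau_{kl})_{k,l=1}^n$ are symmetric positive definite covariance matrices. Write $\sigma_{kk}=\sigma_k^2$ and $\tau_{kk}=\tau_k^2$ with $\sigma_k,\tau_k>0$. The correlation coefficient between surfaces $k$ and $l$ is denoted $\rho_{kl}$ (so $\rho_{kk}=1$) and is the same for both players: $\sigma_{kl}=\rho_{kl}\sigma_k\sigma_l$ and $\tau_{kl}=\rho_{kl}\tau_k\tau_l$. Put $\boldsymbol\theta=(\boldsymbol\theta_i^T,\boldsymbol\theta_j^T)^T\in\mathbb R^{2n}$, $\boldsymbol\mu=(\boldsymbol\mu_i^T,\boldsymbol\mu_j^T)^T$, so $\boldsymbol\theta\sim N(\boldsymbol\mu,\Sigma)$ with $\Sigma=\mathrm{diag}(\Lambda_i,\Lambda_j)$. Let $b=\log(10)/400$. If the game is played on surface $m$, the win probability of $i$ against $j$ is $p_{ij}(\boldsymbol\theta)=e^{b\theta_{im}}/(e^{b\theta_{im}}+e^{b\theta_{jm}})$, and $p_{ji}(\boldsymbol\theta)=1-p_{ij}(\boldsymbol\theta)$. The outcome is $s_{ij}\in\{0,1\}$, with $s_{ij}=1$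 if $i$ wins and $s_{ij}=0$ if $i$ loses; $s_{ji}=1-s_{ij}$. The log-posterior (up to an additive constant) is $$\ell(\boldsymbol\theta)=-\tfrac12(\boldsymbol\theta-\boldsymbol\mu)^T\Sigma^{-1}(\boldsymbol\theta-\boldsymbol\mu)+s_{ij}\log p_{ij}(\boldsymbol\theta)+(1-s_{ij})\log(1-p_{ij}(\boldsymbol\theta)).$$ $J(\boldsymbol\theta)=\nabla\ell(\boldsymbol\theta)\in\mathbb R^{2n}$ is its gradient and $H(\boldsymbol\theta)=\nabla^2\ell(\boldsymbol\theta)$ its $2n\times2n$ Hessian. *)

(* Defs.v *)
From HB Require Import structures.
From mathcomp Require Import all_boot all_order all_algebra.
From mathcomp Require Import all_classical all_reals all_analysis.

Set Implicit Arguments.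
Unset Strict Implicit.
Unset Printing Implicit Defensive.

Import Order.TTheory GRing.Theory Num.Theory.
Import numFieldNormedType.Exports.

Local Open Scope ring_scope.

Definition posdefmx (R : realType) (n : nat) (A : 'M[R]_n) : Prop :=
  A^T = A /\ forall v : 'cV[R]_n, v != 0 -> 0 < (v^T *m A *m v) 0 0.

(* 'D_v f x is a total operator (0 when the limit does not exist); both
   operators below are meant for functions that are smooth enough. *)
Definition gradient (R : realType) (N : nat) (f : 'cV[R]_N -> R)
    (x : 'cV[R]_N) : 'cV[R]_N :=
  \col_k 'D_(delta_mx k 0) f x.

Definition hessian (R : realType) (N : nat) (f : 'cV[R]_N -> R)
    (x : 'cV[R]_N) : 'M[R]_N :=
  \matrix_(k, l) 'D_(delta_mx l 0) (fun y => 'D_(delta_mx k 0) f y) x.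

Definition elo_b (R : realType) : R := ln 10 / 400.

(* The strength vectors of the two players are stacked: usubmx theta is
   theta_i and dsubmx theta is theta_j. *)
Definition win_prob (R : realType) (n : nat) (m : 'I_n)
    (theta : 'cV[R]_(n + n)) : R :=
  let thi := usubmx theta in
  let thj := dsubmx theta in
  expR (elo_b R * thi m 0) /
    (expR (elo_b R * thi m 0) + expR (elo_b R * thj m 0)).

Definition prior_cov (R : realType) (n : nat) (Li Lj : 'M[R]_n) :
    'M[R]_(n + n) :=
  block_mx Li 0 0 Lj.

(* Log-posterior without its additive constant; s is the outcome, 1 if player
   i wins and 0 if player i loses. *)
Definition log_posterior (R : realType) (n : nat) (m : 'I_n)
    (mu : 'cV[R]_(n + n)) (Sigma : 'M[R]_(n + n)) (s : R)
    (theta : 'cV[R]_(n + n)) : R :=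
  - (2^-1 * ((theta - mu)^T *m invmx Sigma *m (theta - mu)) 0 0)
  + s * ln (win_prob m theta) + (1 - s) * ln (1 - win_prob m theta).

(* Main.v *)
(* The game is a logistic regression with the single covariate
   w = b (e_m, - e_m): the win probability is p = logistic (w^T theta). Hence
   J(mu) = (s - p) w and H(mu) = - (Sigma^-1 + p (1 - p) w w^T), a rank-one
   perturbation of Sigma^-1 that the Sherman-Morrison formula shows invertible.
   The Newton step is then (s - p) / (1 + p (1 - p) w^T Sigma w) Sigma w, and
   Sigma w is read off the m-th columns of the two prior covariances. *)

Require Import Defs.
From HB Require Import structures.
From mathcomp Require Import all_boot all_order all_algebra.
From mathcomp Require Import all_classical all_reals all_analysis.
From mathcomp Require Import ring lra.
Import Order.TTheory GRing.Theory Num.Theory.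
Import numFieldNormedType.Exports.
Local Open Scope ring_scope.

(** * Positive definite matrices and rank-one perturbations *)

Lemma posdefmx_unit {R : realType} {n : nat} {A : 'M[R]_n} :
  posdefmx A -> A \in unitmx.
Proof.
case=> _ Apos; rewrite unitmxE unitfE; apply/det0P => -[v v0 vA].
have := Apos v^T; rewrite trmxK vA mul0mx mxE ltxx -trmx0 (inj_eq trmx_inj).
by move=> /(_ v0).
Qed.

Lemma posdefmx_ge0 {R : realType} {n : nat} {A : 'M[R]_n} (v : 'cV[R]_n) :
  posdefmx A -> 0 <= (v^T *m A *m v) 0 0.
Proof.
by case=> _ Apos; have [->|/Apos/ltW//] := eqVneq v 0; rewrite mulmx0 mxE.
Qed.

(** Since [w^T *m A *m w] is a scalar [q], every term of the product except the identity is a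
    multiple of [w *m w^T *m A], and the coefficients add up to zero. *)
Lemma Sherman_Morrison {R : realType} {n : nat} {A : 'M[R]_n} {w : 'cV[R]_n}
    {c : R} :
  A \in unitmx -> 1 + c * (w^T *m A *m w) 0 0 != 0 ->
  (invmx A + c *: (w *m w^T)) *m
    (A - (c / (1 + c * (w^T *m A *m w) 0 0)) *: (A *m w *m w^T *m A)) = 1%:M.
Proof.
move=> Au; set q := (w^T *m A *m w) 0 0 => q0.
have qE : w^T *m A *m w = q%:M by rewrite [LHS]mx11_scalar.
rewrite mulmxDl !mulmxBr mulVmx // -!scalemxAr -!scalemxAl !mulmxA mulVmx //.
rewrite mul1mx -(mulmxA w) -(mulmxA w (w^T *m A)) qE mulmxA mul_mx_scalar.
rewrite -!scalemxAl scalerA -addrA; set W := w *m w^T *m A.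
rewrite -[RHS]addr0; congr (_ + _).
rewrite scalerA -scaleNr -scalerBl -scalerDl.
set k := (X in X *: _); suff -> : k = 0 by rewrite scale0r.
by rewrite /k; field.
Qed.

(** * The logistic function and its antiderivative *)

Definition logistic {R : realType} (t : R) : R := expR t / (1 + expR t).

Lemma expR1_gt0 {R : realType} (t : R) : 0 < 1 + expR t.
Proof. by rewrite addr_gt0 // expR_gt0. Qed.

Lemma logistic_gt0 {R : realType} (t : R) : 0 < logistic t.
Proof. by rewrite divr_gt0 ?expR_gt0 ?expR1_gt0. Qed.

Lemma onem_logistic {R : realType} (t : R) :
  1 - logistic t = (1 + expR t)^-1.
Proof. by have := expR1_gt0 t; rewrite /logistic => ?; field; lra. Qed.

Lemma logistic_lt1 {R : realType} (t : R) : 0 < 1 - logistic t.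
Proof. by rewrite onem_logistic invr_gt0 expR1_gt0. Qed.

Lemma is_derive_1DexpR {R : realType} (t : R) :
  is_derive t 1 (fun t => 1 + expR t) (expR t).
Proof.
have := is_deriveD (is_derive_cst (1 : R) t 1) (is_derive_expR t).
by rewrite add0r.
Qed.

Lemma is_derive_softplus {R : realType} (t : R) :
  is_derive t 1 (fun t => ln (1 + expR t)) (logistic t).
Proof.
rewrite /logistic mulrC.
exact: (@is_derive1_comp _ (@ln R) (fun t => 1 + expR t) t _ _
  (is_derive1_ln (expR1_gt0 t)) (is_derive_1DexpR t)).
Qed.

Lemma is_derive_logistic {R : realType} (t : R) :
  is_derive t 1 logistic (logistic t * (1 - logistic t)).
Proof.
(* Written as one minus a reciprocal, the function needs only the rule for inverses. *)
rewrite [X in is_derive _ _ X](_ : _ =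
  cst 1 - (fun t : R => (1 + expR t)^-1)); last first.
  by apply/funext => u; rewrite /= -[LHS](subKr 1) onem_logistic.
have h0 : 1 + expR t != 0 by rewrite gt_eqF ?expR1_gt0.
have := is_deriveB (is_derive_cst (1 : R) t 1)
  (@is_deriveV _ (fun t => 1 + expR t) _ _ _ h0 (is_derive_1DexpR t)).
rewrite sub0r scaleNr opprK [_ *: _]mulrC => h; apply: is_derive_eq h _.
by rewrite !onem_logistic /logistic; field.
Qed.

(** * Directional derivatives as derivatives along a line *)

Lemma is_derive_affine {R : realType} (a b t : R) :
  is_derive t 1 (fun h => a + b * h) b.
Proof.
have := is_deriveD (is_derive_cst a t 1) (is_deriveZ b (is_derive_id t 1)).
by rewrite add0r [_ *: _]mulr1.
Qed.

Lemma is_derive_quadratic {R : realType} (a b c : R) :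
  is_derive (0 : R) 1 (fun h => a + b * h + c * h ^+ 2) b.
Proof.
have := is_deriveD (is_derive_affine a b 0)
  (is_deriveZ c (is_deriveX 2 (is_derive_id (0 : R) 1))).
by rewrite expr1 mulr0 scale0r scaler0 addr0.
Qed.

Lemma is_derive_comp_affine {R : realType} (G : R -> R) (a b g : R) :
  is_derive a 1 G g -> is_derive (0 : R) 1 (fun h => G (a + b * h)) (g * b).
Proof.
move=> dG; apply: (@is_derive1_comp _ G (fun h => a + b * h)).
  by rewrite mulr0 addr0.
exact: is_derive_affine.
Qed.

(** The difference quotient of [f] along [v] only involves the line through [x], so it is that of
    [g] at 0. Derivability of [g] ensures that the limit exists and [d] is not a default value. *)
Lemma derive_line {R : realType} {N : nat} (f : 'cV[R]_N -> R) (g : R -> R)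
    (x v : 'cV[R]_N) (d : R) :
  (forall h, f (x + h *: v) = g h) -> is_derive (0 : R) 1 g d -> 'D_v f x = d.
Proof.
move=> fg [_ <-]; rewrite /derive.
have -> // : (fun h : R => h^-1 *: ((f \o shift x) (h *: v) - f x))
  = (fun h : R => h^-1 *: ((g \o shift 0) (h *: (1 : R)) - g 0)).
apply/funext => h /=.
by rewrite [h *: v + x]addrC [h *: 1]mulr1 addr0 -!fg scale0r addr0.
Qed.

(* The log-posterior of a logistic regression with covariate [w], outcome [s]
   and Gaussian prior of mean [mu] and precision [S]. It uses
   [s * ln p + (1 - s) * ln (1 - p) = s * t - ln (1 + expR t)] when
   [p = logistic t]. *)
Definition logit_posterior {R : realType} {N : nat} (S : 'M[R]_N)
    (mu w : 'cV[R]_N) (s : R) (x : 'cV[R]_N) : R :=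
  - (2^-1 * ((x - mu)^T *m S *m (x - mu)) 0 0)
  + (s * (w^T *m x) 0 0 - ln (1 + expR ((w^T *m x) 0 0))).

Lemma addmxE {R : realType} {p q : nat} (A B : 'M[R]_(p, q)) i j :
  (A + B) i j = A i j + B i j.
Proof. by rewrite mxE. Qed.

Lemma scalemxE {R : realType} {p q : nat} (a : R) (A : 'M[R]_(p, q)) i j :
  (a *: A) i j = a * A i j.
Proof. by rewrite mxE. Qed.

Lemma quadratic_form_line {R : realType} {N : nat} (S : 'M[R]_N)
    (x v : 'cV[R]_N) (h : R) : S^T = S ->
  ((x + h *: v)^T *m S *m (x + h *: v)) 0 0 =
  (x^T *m S *m x) 0 0 + 2 * h * (v^T *m S *m x) 0 0
  + h ^+ 2 * (v^T *m S *m v) 0 0.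
Proof.
move=> S_sym; have -> : (x + h *: v)^T = x^T + h *: v^T.
  by rewrite linearD linearZ.
rewrite !mulmxDl !mulmxDr -!scalemxAl -!scalemxAr !addmxE !scalemxE.
(* The two cross terms are transposes of each other because [S] is symmetric. *)
have -> : (x^T *m S *m v) 0 0 = (v^T *m S *m x) 0 0.
  by rewrite -[_ *m v]trmxK mxE !trmx_mul trmxK S_sym mulmxA.
by ring.
Qed.

(** * Gradient and Hessian of the logistic log-posterior *)

Section LogitPosterior.
Context {R : realType} {N : nat} (S : 'M[R]_N) (mu w : 'cV[R]_N) (s : R).
Hypothesis S_sym : S^T = S.

Lemma derive_logit_posterior (v x : 'cV[R]_N) :
  'D_v (logit_posterior S mu w s) x =
  - (v^T *m S *m (x - mu)) 0 0
  + (s - logistic ((w^T *m x) 0 0)) * (w^T *m v) 0 0.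
Proof.
pose A := ((x - mu)^T *m S *m (x - mu)) 0 0.
pose B := (v^T *m S *m (x - mu)) 0 0.
pose D := (v^T *m S *m v) 0 0.
pose u := (w^T *m x) 0 0; pose c := (w^T *m v) 0 0.
(* On the line, the log-posterior is a quadratic polynomial in [h] minus [ln (1 + expR _)] of an
   affine function. *)
apply: (@derive_line _ _ _ (fun h => (- (2^-1 * A) + s * u)
    + (- B + s * c) * h + (- (2^-1 * D)) * h ^+ 2 - ln (1 + expR (u + c * h)))).
  move=> h; rewrite /logit_posterior.
  have -> : (w^T *m (x + h *: v)) 0 0 = u + c * h.
    by rewrite mulmxDr -scalemxAr addmxE scalemxE mulrC.
  have -> : x + h *: v - mu = (x - mu) + h *: v by rewrite addrAC.
  rewrite quadratic_form_line // -/A -/B -/D.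
  by field.
have := is_deriveB (is_derive_quadratic (- (2^-1 * A) + s * u) (- B + s * c)
  (- (2^-1 * D))) (@is_derive_comp_affine _ (fun t => ln (1 + expR t)) u c _
  (is_derive_softplus u)).
by move=> h; apply: is_derive_eq h _; rewrite -/B -/u -/c; ring.
Qed.

Lemma derive2_logit_posterior (v v' x : 'cV[R]_N) :
  'D_v' (fun y => 'D_v (logit_posterior S mu w s) y) x =
  - (v^T *m S *m v') 0 0
  - logistic ((w^T *m x) 0 0) * (1 - logistic ((w^T *m x) 0 0))
    * (w^T *m v) 0 0 * (w^T *m v') 0 0.
Proof.
pose B := (v^T *m S *m (x - mu)) 0 0.
pose D := (v^T *m S *m v') 0 0.
pose u := (w^T *m x) 0 0; pose c := (w^T *m v) 0 0; pose c' := (w^T *m v') 0 0.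
(* The formula for the first derivative holds at every point; on the line it is affine in [h] apart
   from the logistic term. *)
apply: (@derive_line _ _ _ (fun h => (- B + s * c) + (- D) * h
   - c * logistic (u + c' * h))).
  move=> h; rewrite derive_logit_posterior.
  have -> : (w^T *m (x + h *: v')) 0 0 = u + c' * h.
    by rewrite mulmxDr -scalemxAr addmxE scalemxE mulrC.
  have -> : x + h *: v' - mu = (x - mu) + h *: v' by rewrite addrAC.
  rewrite mulmxDr -scalemxAr addmxE scalemxE -/B -/D -/c; ring.
have := is_deriveB (is_derive_affine (- B + s * c) (- D) 0)
  (is_deriveZ c
     (@is_derive_comp_affine _ logistic u c' _ (is_derive_logistic u))).
move=> h; apply: is_derive_eq h _; rewrite [_ *: _]mulrA -/D -/u -/c -/c'; ring.
Qed.

Let e_dot (u : 'cV[R]_N) (k : 'I_N) :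
  (u^T *m (delta_mx k 0 : 'cV_N)) 0 0 = u k 0.
Proof. by rewrite -colE !mxE. Qed.

(** At the prior mean the contribution of the prior vanishes, which leaves the likelihood alone. *)
Lemma gradient_logit_posterior :
  gradient (logit_posterior S mu w s) mu
  = (s - logistic ((w^T *m mu) 0 0)) *: w.
Proof.
apply/colP => k; rewrite scalemxE mxE derive_logit_posterior e_dot.
by rewrite subrr mulmx0 [X in - X]mxE oppr0 add0r.
Qed.

Lemma hessian_logit_posterior (x : 'cV[R]_N) :
  let p := logistic ((w^T *m x) 0 0) in
  hessian (logit_posterior S mu w s) x = - (S + (p * (1 - p)) *: (w *m w^T)).
Proof.
apply/matrixP => k l; rewrite mxE derive2_logit_posterior !e_dot.
rewrite trmx_delta -rowE -colE !mxE big_ord1 !mxE; ring.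
Qed.

End LogitPosterior.

(** * The Newton step from the prior mean *)

Lemma newton_logit_posterior {R : realType} {N : nat} {A : 'M[R]_N}
    (mu w : 'cV[R]_N) (s : R) :
  posdefmx A ->
  let ell := logit_posterior (invmx A) mu w s in
  let p := logistic ((w^T *m mu) 0 0) in
  hessian ell mu \in unitmx /\
  - (invmx (hessian ell mu) *m gradient ell mu) =
  ((s - p) / (1 + p * (1 - p) * (w^T *m A *m w) 0 0)) *: (A *m w).
Proof.
move=> Apd ell p; have Au := posdefmx_unit Apd.
have q_ge0 := posdefmx_ge0 w Apd.
set q := (w^T *m A *m w) 0 0 in q_ge0 *; pose c := p * (1 - p).
have c0 : 0 < c by rewrite mulr_gt0 ?logistic_gt0 ?logistic_lt1.
(* As [c > 0] and [q >= 0], the denominator is at least 1. *)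
have d0 : 1 + c * q != 0 by rewrite gt_eqF // ltr_wpDr // mulr_ge0 // ltW.
have Ssym : (invmx A)^T = invmx A by rewrite trmx_inv; have [->] := Apd.
have HE : hessian ell mu = - (invmx A + c *: (w *m w^T)).
  exact: hessian_logit_posterior.
have /mulmx1_unit[Mu _] := Sherman_Morrison Au d0.
have Hu : hessian ell mu \in unitmx by rewrite HE -scaleN1r unitmxZ ?unitrN1.
split=> //; rewrite gradient_logit_posterior // -/p.
(* The claimed step is checked by applying the Hessian to it:
   [(invmx A + c *: (w *m w^T)) *m (A *m w)] equals [(1 + c * q) *: w]. *)
rewrite -[RHS](mulKmx Hu) -mulmxN; congr (_ *m _).
rewrite HE -scalemxAr mulNmx mulmxDl mulKmx // -scalemxAl -mulmxA (mulmxA w^T).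
rewrite [w^T *m A *m w]mx11_scalar -/q mul_mx_scalar scalerA -{2}[w]scale1r.
by rewrite -scalerDl scalerN scalerA divfK.
Qed.

(** * The game as a logistic regression *)

Definition game_covariate {R : realType} {n : nat} (m : 'I_n) :
    'cV[R]_(n + n) :=
  elo_b R *: col_mx (delta_mx m 0) (- delta_mx m 0).

Lemma game_covariate_dot {R : realType} {n : nat} (m : 'I_n)
    (x : 'cV[R]_(n + n)) :
  ((game_covariate m)^T *m x) 0 0 =
  elo_b R * usubmx x m 0 - elo_b R * dsubmx x m 0.
Proof.
rewrite /game_covariate linearZ /= tr_col_mx -[x in LHS]vsubmxK -scalemxAl.
rewrite mul_row_col linearN /= mulNmx !trmx_delta -!rowE scalemxE addmxE.
by rewrite [(- row _ _) 0 0]mxE ![row _ _ 0 0]mxE mulrBr.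
Qed.

(** Divide numerator and denominator by the exponential of player j. *)
Lemma win_prob_logistic {R : realType} {n : nat} (m : 'I_n)
    (x : 'cV[R]_(n + n)) :
  win_prob m x = logistic (((game_covariate m)^T *m x) 0 0).
Proof.
rewrite game_covariate_dot /win_prob /logistic expRB.
set a := expR (_ * usubmx _ _ _); set c := expR (_ * dsubmx _ _ _).
have a0 : 0 < a by rewrite expR_gt0.
have c0 : 0 < c by rewrite expR_gt0.
by field; rewrite !gt_eqF // addr_gt0.
Qed.

Lemma ln_logistic {R : realType} (t : R) :
  ln (logistic t) = t - ln (1 + expR t).
Proof. by rewrite ln_div ?expRK // posrE ?expR_gt0 ?expR1_gt0. Qed.

Lemma ln_onem_logistic {R : realType} (t : R) :
  ln (1 - logistic t) = - ln (1 + expR t).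
Proof. by rewrite onem_logistic lnV // posrE expR1_gt0. Qed.

Lemma log_posterior_logit {R : realType} {n : nat} (m : 'I_n)
    (mu : 'cV[R]_(n + n)) (Sigma : 'M[R]_(n + n)) (s : R) :
  log_posterior m mu Sigma s
  = logit_posterior (invmx Sigma) mu (game_covariate m) s.
Proof.
apply/funext => x; rewrite /log_posterior /logit_posterior.
rewrite win_prob_logistic ln_logistic ln_onem_logistic -addrA.
by congr (_ + _); ring.
Qed.

(** The quadratic form is the sum of those of the two blocks, and a nonzero stacked vector has a
    nonzero half. *)
Lemma posdefmx_prior_cov {R : realType} {n : nat} {Li Lj : 'M[R]_n} :
  posdefmx Li -> posdefmx Lj -> posdefmx (prior_cov Li Lj).
Proof.
move=> Lipd Ljpd; have [Lis Lip] := Lipd; have [Ljs Ljp] := Ljpd.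
split; first by rewrite tr_block_mx !trmx0 Lis Ljs.
move=> v; rewrite -[v]vsubmxK; move: (usubmx v) (dsubmx v) => x y.
rewrite tr_col_mx mul_row_block !mulmx0 addr0 add0r mul_row_col addmxE.
have [->|x0 _] := eqVneq x 0; last by rewrite ltr_pwDl ?Lip ?posdefmx_ge0.
have [->|y0 _] := eqVneq y 0; first by rewrite col_mx0 eqxx.
by rewrite ltr_wpDl ?Ljp ?posdefmx_ge0.
Qed.

Theorem proposition2 (R : realType) (n : nat) (hn : (1 <= n)%N) (m : 'I_n)
    (mu_i mu_j : 'cV[R]_n) (Lambda_i Lambda_j : 'M[R]_n)
    (sigma tau : 'I_n -> R) (rho : 'I_n -> 'I_n -> R) (s_ij : R)
    (hLi : posdefmx Lambda_i) (hLj : posdefmx Lambda_j)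
    (hsigma : forall k, 0 < sigma k) (htau : forall k, 0 < tau k)
    (hsigma2 : forall k, Lambda_i k k = sigma k ^+ 2)
    (htau2 : forall k, Lambda_j k k = tau k ^+ 2)
    (hrho : forall k, rho k k = 1)
    (hcor_i : forall k l, Lambda_i k l = rho k l * sigma k * sigma l)
    (hcor_j : forall k l, Lambda_j k l = rho k l * tau k * tau l)
    (hs : s_ij = 0 \/ s_ij = 1) :
  let b := elo_b R in
  let mu := col_mx mu_i mu_j in
  let ell := log_posterior m mu (prior_cov Lambda_i Lambda_j) s_ij in
  let J := gradient ell in
  let H := hessian ell in
  let s_ji := 1 - s_ij in
  let p_ij := win_prob m mu in
  let p_ji := 1 - p_ij in
  let C := (1 + b ^+ 2 * p_ij * p_ji * (sigma m ^+ 2 + tau m ^+ 2))^-1 in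
  let k_i := (b * C * sigma m) *: \col_k (sigma k * rho k m) in
  let k_j := (b * C * tau m) *: \col_k (tau k * rho k m) in
  H mu \in unitmx /\
  - (invmx (H mu) *m J mu) =
    col_mx ((s_ij - p_ij) *: k_i) ((s_ji - p_ji) *: k_j).
Proof.
move=> b mu ell J H s_ji p_ij p_ji C k_i k_j.
have SwE : prior_cov Lambda_i Lambda_j *m game_covariate m
    = b *: col_mx (col m Lambda_i) (- col m Lambda_j).
  rewrite -scalemxAr mul_block_col !mul0mx addr0 add0r mulmxN.
  by rewrite -!colE.
(* The sign of the second half of the covariate occurs twice, so the variances on surface [m]
   add. *)
have qE : ((game_covariate m)^T *m prior_cov Lambda_i Lambda_j
    *m game_covariate m) 0 0 = b ^+ 2 * (sigma m ^+ 2 + tau m ^+ 2).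
  rewrite -mulmxA SwE game_covariate_dot -/b scale_col_mx col_mxKu col_mxKd.
  by rewrite !mxE hsigma2 htau2; ring.
have := newton_logit_posterior mu (game_covariate m) s_ij
  (posdefmx_prior_cov hLi hLj).
rewrite -log_posterior_logit -win_prob_logistic qE SwE => -[Hu ->].
split=> //; rewrite -/p_ij -/p_ji.
have -> : 1 + p_ij * p_ji * (b ^+ 2 * (sigma m ^+ 2 + tau m ^+ 2)) = C^-1.
  by rewrite invrK; ring.
rewrite invrK scalerA scale_col_mx; congr col_mx; apply/colP => k; rewrite !mxE.
  by rewrite hcor_i; ring.
(* The minus sign of the second block is absorbed by [s_ji - p_ji = - (s_ij - p_ij)]. *)
by rewrite hcor_j /s_ji /p_ji; ring.
Qed.
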